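(* Every $\mathcal{LS}$-flow on $\mathbb{H}$ satisfies Property-(C): if $\varphi$ is an $\mathcal{LS}$-flow and $\{x_n\}_{n\in\mathbb{N}}\subset\mathbb{H}$ is a sequence for which the set $\bigcup_{n\in\mathbb{N}}\varphi([-n,n],x_n)$ is bounded, then $\{x_n\}_{n\in\mathbb{N}}$ has a convergent subsequence.
   Context: $\mathbb{H}$ is a real separable Hilbert space. $L:\mathbb{H}\to\mathbb{H}$ is a fixed bounded selfadjoint invertible linear operator for which there is an increasing sequence of finite-dimensional subspaces $E_n\subset\mathbb{H}$ with $\overline{\bigcup_n E_n}=\mathbb{H}$ and $L(E_n)=E_n$. An $\mathcal{LS}$-vector field is a globally Lipschitz vector field $F=L+K$ on $\mathbb{H}$ where $K$ is completely continuous, i.e. $K$ maps bounded sets into precompact sets. An $\mathcal{LS}$-flow is a flow $\varphi(t,x)$ generated by an $\mathcal{LS}$-vector field. *)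

(* Defs.v *)
From HB Require Import structures.
From mathcomp Require Import all_boot all_order all_algebra.
From mathcomp Require Import all_classical all_reals all_analysis.

Set Implicit Arguments.
Unset Strict Implicit.
Unset Printing Implicit Defensive.

Import Order.TTheory GRing.Theory Num.Theory.
Import numFieldNormedType.Exports.

Local Open Scope classical_set_scope.
Local Open Scope ring_scope.

(* A real Hilbert space is a complete normed space [H] together with an inner
   product inducing its norm. *)
Definition induces_norm (R : realType) (H : completeNormedModType R)
    (dot : {dot H for idfun}) : Prop :=
  forall x : H, dot x x = `|x| ^+ 2.

Definition separable (T : topologicalType) : Prop :=
  exists2 D : set T, countable D & dense D.

Definition bounded_operator (R : realType) (V W : normedModType R)
    (f : V -> W) : Prop :=
  exists M : R, forall x, `|f x| <= M * `|x|.

Definition selfadjoint (R : realType) (H : lmodType R)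
    (dot : {dot H for idfun}) (f : H -> H) : Prop :=
  forall x y : H, dot (f x) y = dot x (f y).

(* Invertibility in the algebra of bounded operators. *)
Definition invertible_operator (R : realType) (V : normedModType R)
    (f : V -> V) : Prop :=
  exists g : {linear V -> V},
    [/\ bounded_operator g, cancel f g & cancel g f].

Definition finite_dim_subspace (R : realType) (V : lmodType R)
    (E : set V) : Prop :=
  exists (k : nat) (e : 'I_k -> V),
    E = range (fun c : 'I_k -> R => \sum_(i < k) c i *: e i).

Record LS_operator (R : realType) (H : completeNormedModType R)
    (dot : {dot H for idfun}) (L : {linear H -> H}) : Prop := {
  LS_operator_bounded : bounded_operator L ;
  LS_operator_selfadjoint : selfadjoint dot L ;
  LS_operator_invertible : invertible_operator L ;
  LS_operator_filtration : exists E : nat -> set H,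
    [/\ forall n, finite_dim_subspace (E n),
        forall n, E n `<=` E n.+1,
        closure (\bigcup_n E n) = [set: H] &
        forall n, L @` E n = E n] }.

(* Continuity is not required separately: where this is used, [K] differs from
   a Lipschitz map by a bounded operator. *)
Definition completely_continuous (R : realType) (V W : normedModType R)
    (K : V -> W) : Prop :=
  forall A : set V, bounded_set A -> precompact (K @` A).

Definition LS_vector_field (R : realType) (H : completeNormedModType R)
    (L : {linear H -> H}) (F : H -> H) : Prop :=
  lipschitz F /\
  exists2 K : H -> H, completely_continuous K & forall x, F x = L x + K x.

Record is_flow (R : realType) (V : normedModType R)
    (phi : R -> V -> V) : Prop := {
  flow_continuous : continuous (fun p : R * V => phi p.1 p.2) ;
  flow0 : forall x, phi 0 x = x ;
  flowD : forall s t x, phi (s + t) x = phi s (phi t x) }.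

Definition generated_by (R : realType) (V : normedModType R)
    (phi : R -> V -> V) (F : V -> V) : Prop :=
  forall (x : V) (t : R), is_derive t 1 (fun s : R => phi s x) (F (phi t x)).

Definition LS_flow (R : realType) (H : completeNormedModType R)
    (L : {linear H -> H}) (phi : R -> H -> H) : Prop :=
  is_flow phi /\ exists2 F : H -> H, LS_vector_field L F & generated_by phi F.

Definition has_convergent_subsequence (T : topologicalType)
    (x : nat -> T) : Prop :=
  exists k : nat -> nat,
    {homo k : i j / (i < j)%N} /\ exists l : T, (x \o k) n @[n --> \oo] --> l.

Definition property_C (R : realType) (V : normedModType R)
    (phi : R -> V -> V) : Prop :=
  forall x : nat -> V,
    bounded_set (\bigcup_n [set phi t (x n) | t in `[- n%:R, n%:R]]) ->
    has_convergent_subsequence x.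

(* Main.v *)
(** Let V = <L w, w> along the difference w of two trajectories, which solves
    w' = L w + k. Since L is selfadjoint, V' = 2 |L w|^2 + 2 <L w, k>
    >= |L w|^2 - |k|^2, and since L is bounded below, |V| <= C |L w|^2. Hence V
    expands away from 0 in both time directions up to an error of order |k|^2,
    so if w is bounded by B and |k| <= eps on [-T, T], then V is of order
    eps^2 + B^2 exp(- c T) on [0, 1]. The mean value theorem applied to V
    yields a time in [0, 1] at which |L w|, hence |w|, is small, and applied to
    |w|^2 it carries this smallness back to time 0. No spectral splitting of L
    is used.

    It remains to make k = K(phi(t, x_n)) - K(phi(t, x_m)) uniformly small on
    [-T, T]. Along an ultrafilter on the naturals finer than the Frechet filter,
    K(phi(t, x_n)) converges for each t because K is completely continuous;
    these curves are equi-Lipschitz, so they are uniformly Cauchy on [-T, T].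
    Thus x_n is Cauchy along the ultrafilter, and its limit is a cluster point
    of the sequence. *)

Require Import Defs.
From HB Require Import structures.
From mathcomp Require Import all_boot all_order all_algebra.
From mathcomp Require Import all_classical all_reals all_analysis.
From mathcomp Require Import ring lra.

Set Implicit Arguments.
Unset Strict Implicit.
Unset Printing Implicit Defensive.

Import Order.TTheory GRing.Theory Num.Theory.
Import numFieldNormedType.Exports.

Local Open Scope classical_set_scope.
Local Open Scope ring_scope.

(** * Derivatives of curves and bounded linear maps *)

Lemma is_derive1_cvgP (R : realType) (V : normedModType R) (f : R -> V)
    (t : R) df :
  is_derive t 1 f df <-> (fun h => h^-1 *: (f (h + t) - f t)) @ 0^' --> df.
Proof.
have E : (fun h => h^-1 *: ((f \o shift t) (h *: (1 : R)) - f t)) =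
  (fun h => h^-1 *: (f (h + t) - f t)).
  by apply/funext => h /=; rewrite [_ *: 1]mulr1.
split=> [[d <-]|h].
  by move: d; rewrite /derive /derivable E.
apply: DeriveDef; first by rewrite /derivable E; apply/cvg_ex; exists df.
by rewrite /derive E; apply/cvg_lim.
Qed.

Lemma is_derive1_cvg_shift (R : realType) (V : normedModType R) (f : R -> V)
    (t : R) df :
  is_derive t 1 f df -> f (h + t) @[h --> 0^'] --> f t.
Proof.
move=> [d _].
suff : {for 0, continuous (fun h : R => f (h *: 1 + t))}.
  move=> /continuous_withinNx; rewrite scale0r add0r.
  by under eq_fun do rewrite [_ *: 1]mulr1.
exact/differentiable_continuous/derivable1_diffP/(derivable1P _ _ _).1.
Qed.

Lemma bounded_operator_ge0 (R : realType) (V W : normedModType R) (f : V -> W) :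
  bounded_operator f -> exists2 M : R, 0 <= M & forall x, `|f x| <= M * `|x|.
Proof.
move=> [M hM]; exists `|M| => // x.
by rewrite (le_trans (hM x))// ler_wpM2r// ler_norm.
Qed.

Lemma bounded_operator_continuous (R : realType) (V W : normedModType R)
  (L : {linear V -> W}) : bounded_operator L -> continuous L.
Proof.
move=> [M hM]; apply/linear_bounded_continuous/linear_boundedP.
near=> r => x; apply: le_trans (hM x) _; apply: ler_wpM2r => //.
Unshelve. all: by end_near. Qed.

Lemma is_derive_linear (R : realType) (V W : normedModType R)
  (L : {linear V -> W}) (f : R -> V) (t : R) df : continuous L ->
  is_derive t 1 f df -> is_derive t 1 (L \o f) (L df).
Proof.
move=> cL /is_derive1_cvgP h; apply/is_derive1_cvgP => /=.
under eq_fun do rewrite -linearB -linearZ.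
exact: (cvg_comp _ _ h (cL df)).
Qed.

(** * Scalar differential inequalities *)

Lemma is_derive_MVT (R : realType) (f df : R -> R) (a b : R) : a <= b ->
  (forall t : R, is_derive t 1 f (df t)) ->
  exists2 c, c \in `[a, b]%R & f b - f a = df c * (b - a).
Proof.
move=> ab hf; apply: MVT_segment => //.
apply: continuous_subspaceT => t.
apply/differentiable_continuous/derivable1_diffP.
exact: (@ex_derive _ _ _ _ _ _ _ (hf t)).
Qed.

(** Gronwall's integrating factor: [W t * expR (- c * t)] has derivative
    [(dW t - c * W t) * expR (- c * t)], which is nonnegative on [a, b]. *)
Lemma expR_weight_le (R : realType) (W dW : R -> R) (c a b : R) : a <= b ->
  (forall t : R, is_derive t 1 W (dW t)) ->
  (forall t, a <= t <= b -> c * W t <= dW t) ->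
  W a * expR (- c * a) <= W b * expR (- c * b).
Proof.
move=> ab hW ge; rewrite -subr_ge0.
have df (t : R) : is_derive t 1 (W * (expR \o (- c \*: id)))
    ((dW t - c * W t) * expR (- c * t)).
  apply: is_derive_eq.
  rewrite /GRing.scale /=; ring.
have [x xab ->] := is_derive_MVT ab df.
by rewrite mulr_ge0 ?subr_ge0// mulr_ge0 ?expR_ge0// subr_ge0 ge.
Qed.

(** Forward in time [V - a / k] grows at rate at least [k], and backward in time so does
    [- (V + a / k)]; a large value of either at [t] would outgrow [N] by time [T] or [- T]. *)
Lemma abs_le_of_expanding (R : realType) (V dV : R -> R) (k a N T t : R) :
  0 < k -> 0 <= a -> (forall t : R, is_derive t 1 V (dV t)) ->
  (forall t, `|t| <= T -> k * `|V t| - a <= dV t) ->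
  (forall t, `|t| <= T -> `|V t| <= N) ->
  `|t| <= T ->
  `|V t| <= a / k + N * expR (- k * (T - `|t|)).
Proof.
move=> k0 a0 hV ge bd tT.
have T0 : 0 <= T by exact: le_trans tT.
have N0 : 0 <= N by apply: le_trans (bd 0 _); rewrite ?normr0.
have [hV1 hV2] : (forall s : R, is_derive s 1 (V - cst (a / k)) (dV s)) /\
    (forall s : R, is_derive s 1 (V + cst (a / k)) (dV s)).
  by split=> s; apply: is_derive_eq; rewrite ?subr0 ?addr0.
have ak : 0 <= a / k by rewrite divr_ge0// ltW.
have kak : k * (a / k) = a by rewrite mulrC divfK// gt_eqF.
move: (tT); rewrite ler_norml => /andP[Tt tT'].
have TT : `|T| <= T by rewrite ger0_norm.
have bdT := bd _ TT; have bdNT : `|V (- T)| <= N by apply: bd; rewrite normrN.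
have up : V t - a / k <= N * expR (- k * (T - t)).
  have : (V t - a / k) * expR (- k * t) <= (V T - a / k) * expR (- k * T).
    apply: (expR_weight_le tT' hV1) => s /andP[ts sT] /=.
    have /ge : `|s| <= T by rewrite ler_norml sT (le_trans Tt).
    have : k * V s <= k * `|V s| by rewrite ler_pM2l// ler_norm.
    by rewrite -[(V - _) s]/(V s - a / k) mulrBr kak; lra.
  rewrite -ler_pdivlMr ?expR_gt0// mulrBr expRB mulrA => /le_trans; apply.
  rewrite ler_pM2r ?invr_gt0 ?expR_gt0// ler_pM2r ?expR_gt0//.
  by move: bdT; rewrite ler_norml => /andP[_]; lra.
(* Here [expR_weight_le] is used at the rate [- k] on [-T, t], hence the double signs. *)
have down : - (N * expR (- k * (T + t))) <= V t + a / k.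
  have : (V (- T) + a / k) * expR (- - k * - T) <=
         (V t + a / k) * expR (- - k * t).
    apply: (expR_weight_le Tt hV2) => s /andP[ts sT] /=.
    have /ge : `|s| <= T by rewrite ler_norml ts (le_trans sT).
    have : k * - V s <= k * `|V s| by rewrite ler_pM2l// -normrN ler_norm.
    by rewrite -[(V + _) s]/(V s + a / k) mulrDr !mulNr kak; lra.
  rewrite -ler_pdivrMr ?expR_gt0// opprK mulrN mulNr => /(le_trans _); apply.
  rewrite mulrDr opprD expRD [expR (- (k * t))]expRN mulrA -!mulNr.
  rewrite ler_pM2r ?invr_gt0 ?expR_gt0// ler_pM2r ?expR_gt0//.
  by move: bdNT; rewrite ler_norml => /andP[+ _]; lra.
have decay s : T - `|t| <= s ->
    N * expR (- k * s) <= N * expR (- k * (T - `|t|)).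
  by move=> h; apply: ler_wpM2l => //; rewrite ler_expR ler_nM2l ?oppr_lt0.
have d1 : T - `|t| <= T - t by rewrite lerB// ler_norm.
have d2 : T - `|t| <= T + t by rewrite lerD2l lerNl -normrN ler_norm.
have := decay _ d1; have := decay _ d2.
by rewrite ler_norml => *; apply/andP; split; lra.
Qed.

(** * Inner product: Cauchy-Schwarz, continuity and product rule *)

Section InnerProduct.
Variables (R : realType) (H : completeNormedModType R).
Variable dot : {dot H for idfun}.
Hypothesis hdot : induces_norm dot.

Lemma dotC x y : dot x y = dot y x.
Proof. by rewrite hermC expr0 mul1r. Qed.

Lemma dot_normD x y : `|x + y| ^+ 2 = `|x| ^+ 2 + 2 * dot x y + `|y| ^+ 2.
Proof.
by rewrite -!hdot linearDl !linearDr /= (dotC y x); ring.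
Qed.

Lemma dot_polarization x y : dot x y = (`|x + y| ^+ 2 - `|x - y| ^+ 2) / 4.
Proof. by rewrite !dot_normD linearNr normrN /=; field. Qed.

Lemma double_dot_le x y : 2 * `|dot x y| <= `|x| ^+ 2 + `|y| ^+ 2.
Proof.
have := sqr_ge0 `|x + y|; have := sqr_ge0 `|x - y|.
by rewrite !dot_normD linearNr normrN /=; case: (ger0P (dot x y)) => _; lra.
Qed.

Lemma dot_cauchy_schwarz x y : `|dot x y| <= `|x| * `|y|.
Proof.
have [->|x0] := eqVneq x 0; first by rewrite linear0l !normr0 mul0r.
have [->|y0] := eqVneq y 0; first by rewrite linear0r !normr0 mulr0.
have nx : 0 < `|x| by rewrite normr_gt0.
have ny : 0 < `|y| by rewrite normr_gt0.
(* Both rescaled vectors have norm |x| |y|, so the sum of squares becomes twice the square of that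
   product. *)
have := double_dot_le (`|y| *: x) (`|x| *: y).
rewrite linearZl_LR linearZr_LR /= !normrM !normrZ !normr_id.
move=> h; rewrite -(@ler_pM2l _ (`|y| * `|x|)) ?mulr_gt0//.
by move: h; rewrite -!mulrA; lra.
Qed.

(** Polarization reduces continuity of the inner product to that of the norm. *)
Lemma cvg_dot (T : Type) (F : set_system T) (FF : Filter F) (f g : T -> H) a b :
  f @ F --> a -> g @ F --> b -> (fun t => dot (f t) (g t)) @ F --> dot a b.
Proof.
move=> fa gb; rewrite dot_polarization.
under eq_fun do rewrite dot_polarization.
apply: cvgMl; apply: cvgB; rewrite expr2; under eq_fun do rewrite expr2.
  by apply: cvgM; apply: cvg_norm; apply: cvgD.
by apply: cvgM; apply: cvg_norm; apply: cvgB.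
Qed.

Lemma is_derive_dot (f g : R -> H) (t : R) df dg :
  is_derive t 1 f df -> is_derive t 1 g dg ->
  is_derive t 1 (fun s => dot (f s) (g s)) (dot df (g t) + dot (f t) dg).
Proof.
move=> hf hg; apply/is_derive1_cvgP.
have -> : (fun h => h^-1 *: (dot (f (h + t)) (g (h + t)) - dot (f t) (g t))) =
  (fun h => dot (h^-1 *: (f (h + t) - f t)) (g (h + t)) +
            dot (f t) (h^-1 *: (g (h + t) - g t))).
  apply/funext => h.
  rewrite linearZl_LR linearZr_LR /= linearBl linearBr /= /GRing.scale /=; ring.
apply: cvgD; apply: cvg_dot.
- exact/is_derive1_cvgP.
- exact: is_derive1_cvg_shift hg.
- exact: cvg_cst.
- exact/is_derive1_cvgP.
Qed.

End InnerProduct.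

(** * Energy estimate for w' = L w + k *)

Section EnergyEstimate.
Variables (R : realType) (H : completeNormedModType R).
Variables (dot : {dot H for idfun}) (L : {linear H -> H}) (A M : R).
Hypotheses (hdot : induces_norm dot) (L_sa : selfadjoint dot L).
Hypotheses (A0 : 0 <= A) (L_ge : forall x, `|x| <= A * `|L x|).
Hypotheses (M0 : 0 <= M) (L_le : forall x, `|L x| <= M * `|x|).

Lemma double_quadratic_le x : 2 * `|dot (L x) x| <= (1 + A ^+ 2) * `|L x| ^+ 2.
Proof.
apply: le_trans (double_dot_le hdot _ _) _.
have := L_ge x; rewrite -(@ler_pXn2r _ 2%N) ?nnegrE ?mulr_ge0//.
by rewrite exprMn; lra.
Qed.

(** Here [c] is the expansion rate of V and [D] bounds |V| on [-1, 1]. On the right, the first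
    summand bounds |w|^2 at the mean value time of V, the second the change of |w|^2 between time 0
    and that time. *)
Lemma linear_ode_small (w k : R -> H) (B eps T : R) : 1 <= T ->
  (forall t : R, is_derive t 1 w (L (w t) + k t)) ->
  (forall t, `|t| <= T -> `|w t| <= B) ->
  (forall t, `|t| <= T -> `|k t| <= eps) ->
  forall c D : R, c = 2 / (1 + A ^+ 2) ->
  D = eps ^+ 2 / c + 2^-1 * (M ^+ 2 + 1) * B ^+ 2 * expR (- c * (T - 1)) ->
  `|w 0| ^+ 2 <= A ^+ 2 * (2 * D + eps ^+ 2) + (2 * D + 2 * (B * eps)).
Proof.
move=> T1 hw wB keps c D cE DE.
have T0 : 0 <= T by exact: le_trans T1.
have zT : `|0 : R| <= T by rewrite normr0.
have B0 : 0 <= B by exact: le_trans (wB _ zT).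
have eps0 : 0 <= eps by exact: le_trans (keps _ zT).
have A1 : 0 < 1 + A ^+ 2 by rewrite ltr_wpDr ?sqr_ge0.
have c0 : 0 < c by rewrite cE divr_gt0.
have sqle (x y : R) : 0 <= x -> x <= y -> x ^+ 2 <= y ^+ 2.
  by move=> x0 xy; rewrite ler_pXn2r ?nnegrE// (le_trans x0).
have cL : continuous L.
  by apply: bounded_operator_continuous; exists M.
pose V t := dot (L (w t)) (w t).
pose dV t := 2 * `|L (w t)| ^+ 2 + 2 * dot (L (w t)) (k t).
have hV (t : R) : is_derive t 1 V (dV t).
  have hL := is_derive_linear cL (hw t).
  apply: is_derive_eq (is_derive_dot hdot hL (hw t)) _.
  by rewrite L_sa (dotC dot (_ + _)) !linearDr /= hdot /dV; ring.
have dV_ge t : `|t| <= T -> `|L (w t)| ^+ 2 - eps ^+ 2 <= dV t.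
  move=> /keps/(sqle _ _ (normr_ge0 _)) hk.
  have := double_dot_le hdot (L (w t)) (k t).
  have := ler_norm (- dot (L (w t)) (k t)); rewrite normrN /dV; lra.
have V_le t : c * `|V t| <= `|L (w t)| ^+ 2.
  by rewrite cE mulrAC ler_pdivrMr// [leRHS]mulrC; exact: double_quadratic_le.
(* From 2 |V| <= |L w|^2 + |w|^2 <= (M^2 + 1) B^2. *)
pose N := 2^-1 * (M ^+ 2 + 1) * B ^+ 2.
have VN t : `|t| <= T -> `|V t| <= N.
  move=> /wB wtB; have := double_dot_le hdot (L (w t)) (w t).
  have := sqle _ _ (normr_ge0 _) wtB.
  have := sqle _ _ (normr_ge0 _) (le_trans (L_le _) (ler_wpM2l M0 wtB)).
  by rewrite exprMn /N /V; lra.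
have Vsmall t : `|t| <= 1 -> `|V t| <= D.
  move=> t1; have tT := le_trans t1 T1.
  apply: le_trans (abs_le_of_expanding c0 (sqr_ge0 eps) hV _ VN tT) _.
    by move=> s sT; apply: le_trans (dV_ge _ sT); rewrite lerB.
  rewrite DE lerD2l ler_wpM2l//; first by apply: le_trans (VN _ zT).
  by rewrite ler_expR ler_nM2l ?oppr_lt0// lerB.
(* At some [x] in [0, 1] the derivative of [V] is V(1) - V(0) <= 2 D, which bounds |L w|^2 there
   through [dV_ge]. *)
have [x /itvP x01 EV] := is_derive_MVT (@ler01 R) hV.
have [xT x1] : `|x| <= T /\ `|x| <= 1.
  by rewrite ger0_norm ?x01// (le_trans _ T1) ?x01.
have Lx : `|L (w x)| ^+ 2 <= 2 * D + eps ^+ 2.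
  have := dV_ge _ xT; have := Vsmall 1; have := Vsmall 0.
  rewrite normr0 normr1 => /(_ ler01) + /(_ (lexx _)).
  rewrite !ler_norml => /andP[? ?] /andP[? ?]; move: EV; lra.
have Ux : `|w x| ^+ 2 <= A ^+ 2 * (2 * D + eps ^+ 2).
  apply: le_trans (sqle _ _ (normr_ge0 _) (L_ge _)) _.
  by rewrite exprMn ler_wpM2l ?sqr_ge0.
(* The derivative of |w|^2 is 2 <w, L w + k> = 2 V + 2 <w, k>, so it is small on all of [0, 1], even
   where L w might not be. *)
pose dU t := 2 * V t + 2 * dot (w t) (k t).
have hU (t : R) : is_derive t 1 (fun s => dot (w s) (w s)) (dU t).
  apply: is_derive_eq (is_derive_dot hdot (hw t) (hw t)) _.
  by rewrite (dotC dot (_ + _)) linearDr /= (dotC dot (w t) (L _)) /dU; ring.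
have x0 : 0 <= x by rewrite x01.
have [y /itvP y0x] := is_derive_MVT x0 hU; rewrite !hdot subr0 => EU.
have [yT y1] : `|y| <= T /\ `|y| <= 1.
  have y1 : y <= 1 by apply: (@le_trans _ _ x); rewrite ?y0x ?x01.
  by rewrite ger0_norm ?y0x// y1 (le_trans y1).
have dUy : `|dU y| <= 2 * D + 2 * (B * eps).
  have kw : `|dot (w y) (k y)| <= B * eps.
    apply: le_trans (dot_cauchy_schwarz hdot _ _) _.
    by apply: ler_pM; rewrite ?normr_ge0 ?wB ?keps.
  move: (Vsmall _ y1) kw; rewrite /dU.
  move: (V y) (dot (w y) (k y)) (B * eps) => a b d'.
  by rewrite !ler_norml => /andP[? ?] /andP[? ?]; apply/andP; split; lra.
have : `|dU y * x| <= 2 * D + 2 * (B * eps).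
  rewrite normrM; apply: le_trans dUy.
  by rewrite -[leRHS]mulr1 ler_wpM2l.
rewrite -EU ler_norml => /andP[+ _]; move: Ux; lra.
Qed.

(** Choosing [eps] and [T] before [w] and [k] lets one choice serve all pairs of trajectories at
    once. *)
Lemma linear_ode_small_at0 (B e : R) : 0 <= B -> 0 < e ->
  exists eps T : R, [/\ 0 < eps, 1 <= T &
    forall w k : R -> H, (forall t : R, is_derive t 1 w (L (w t) + k t)) ->
      (forall t, `|t| <= T -> `|w t| <= B) ->
      (forall t, `|t| <= T -> `|k t| <= eps) -> `|w 0| <= e].
Proof.
move=> B0 e0.
have A1 : 0 < 1 + A ^+ 2 by rewrite ltr_wpDr ?sqr_ge0.
pose c := 2 / (1 + A ^+ 2); have c0 : 0 < c by rewrite divr_gt0.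
(* [C] collects the coefficients of [eps] in [linear_ode_small] once D <= 2 eps^2 / c and eps^2 <=
   eps are inserted. *)
pose C := A ^+ 2 * (4 / c + 1) + 4 / c + 2 * B.
have C0 : 0 < C.
  rewrite ltr_wpDr ?mulr_ge0// ltr_wpDl ?divr_gt0// mulr_ge0 ?sqr_ge0//.
  by rewrite addr_ge0// divr_ge0// ltW.
pose eps := Num.min 1 (e ^+ 2 / C).
have eps0 : 0 < eps by rewrite lt_min ltr01 divr_gt0// exprn_gt0.
have epsC : C * eps <= e ^+ 2.
  by rewrite mulrC -ler_pdivlMr// ge_min lexx orbT.
have eps1 : eps ^+ 2 <= eps.
  by rewrite expr2 -[leRHS]mulr1 ler_pM2l// ge_min lexx.
pose N := 2^-1 * (M ^+ 2 + 1) * B ^+ 2.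
pose d := eps ^+ 2 / c; have d0 : 0 < d by rewrite divr_gt0// exprn_gt0.
have N0 : 0 <= N by rewrite !mulr_ge0 ?sqr_ge0// addr_ge0 ?sqr_ge0.
(* With T = 1 + y / c the exponential error is N exp(- y), at most [d] because exp(y) >= y = N /
   d. *)
pose y := N / d; have y0 : 0 <= y by rewrite divr_ge0// ltW.
have yc : 0 <= y / c by rewrite divr_ge0// ltW.
exists eps, (1 + y / c); split=> //; first by rewrite lerDl.
move=> w k hw wB keps.
have T1 : 1 <= 1 + y / c by rewrite lerDl.
have := linear_ode_small T1 hw wB keps (erefl c) erefl.
rewrite -/N -/d addrAC subrr add0r mulNr (mulrC c) divfK ?gt_eqF// expRN.
have NE : N / expR y <= d.
  rewrite ler_pdivrMr ?expR_gt0// mulrC -ler_pdivrMr// -/y.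
  by apply: le_trans (expR_ge1Dx y); rewrite lerDr.
set D := d + _ => wD.
have D4 : 2 * D <= 4 / c * eps.
  have : d <= eps / c by rewrite /d ler_pM2r ?invr_gt0.
  by rewrite mulrAC -mulrA /D; lra.
rewrite -(@ler_pXn2r _ 2%N) ?nnegrE ?(ltW e0)//.
apply: le_trans wD _; apply: le_trans epsC.
have : A ^+ 2 * (2 * D + eps ^+ 2) <= A ^+ 2 * (4 / c * eps + eps).
  by rewrite ler_wpM2l ?sqr_ge0// lerD.
by rewrite /C; lra.
Qed.

End EnergyEstimate.

(** * Mean value inequality, cluster points and uniform convergence *)

Lemma curve_lipschitz (R : realType) (H : completeNormedModType R)
    (dot : {dot H for idfun}) (f df : R -> H) (C a b : R) :
  induces_norm dot -> a <= b ->
  (forall t : R, is_derive t 1 f (df t)) ->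
  (forall t, a <= t <= b -> `|df t| <= C) ->
  `|f b - f a| <= C * (b - a).
Proof.
move=> hdot ab hf dfC; set v := f b - f a.
have [->|v0] := eqVneq v 0.
  rewrite normr0 mulr_ge0 ?subr_ge0//.
  by apply: le_trans (dfC a _); rewrite ?lexx ?ab.
(* Pairing with the increment [v] itself reduces to the scalar mean value theorem; a factor |v|
   cancels at the end. *)
have hd (t : R) : is_derive t 1 (fun s => dot (f s) v) (dot (df t) v).
  apply: is_derive_eq (is_derive_dot hdot (hf t) (is_derive_cst v t 1)) _.
  by rewrite linear0r addr0.
have [x xab] := is_derive_MVT ab hd.
rewrite -linearBl -/v /= hdot => E.
rewrite -(@ler_pM2r _ `|v|) ?normr_gt0// -expr2 E mulrAC ler_wpM2r ?subr_ge0//.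
apply: le_trans (ler_norm _) _; apply: le_trans (dot_cauchy_schwarz hdot _ _) _.
by rewrite ler_wpM2r// dfC// (itvP xab).
Qed.

Lemma frequently_near_subsequence (R : realType) (V : normedModType R)
    (x : nat -> V) (l : V) :
  (forall e : R, 0 < e -> forall N, exists2 n, (N <= n)%N & `|l - x n| < e) ->
  has_convergent_subsequence x.
Proof.
move=> h.
have {}h (iN : nat * nat) :
    exists n, (iN.2 <= n)%N /\ `|l - x n| < iN.1.+1%:R^-1.
  by have [|n Nn xn] := h iN.1.+1%:R^-1 _ iN.2; [rewrite invr_gt0|exists n].
have [f hf] := choice h.
(* [f] takes an accuracy index and a lower bound for the chosen index; the bound [(k j).+1] makes
   [k] strictly increasing. *)
pose k := fix k i := if i is j.+1 then f (i, (k j).+1) else f (0%N, 0%N).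
have kP i : `|l - x (k i)| < i.+1%:R^-1.
  by case: i => [|i]; apply: (hf (_, _)).2.
exists k; split.
  apply: (@homo_ltn _ k (fun i j => (i < j)%N)) => [? ? ?|i].
    exact: ltn_trans.
  exact: (hf (i.+1, (k i).+1)).1.
exists l; apply/cvgrPdist_lt => e e0; near=> i => /=.
apply: lt_trans (kP i) _; near: i; exact: near_infty_natSinv_lt (PosNum e0).
Unshelve. all: by end_near. Qed.

(** An ultrafilter converges to each of its cluster points: it contains a given neighbourhood or its
    complement, and clustering rules out the complement. *)
Lemma ultrafilter_cvg_precompact (T : Type) (X : topologicalType)
    (U : set_system T) (f : T -> X) (C : set X) : UltraFilter U ->
  precompact C -> (\forall n \near U, C (f n)) -> exists p : X, f @ U --> p.
Proof.
move=> UU; rewrite precompactE => cC UC.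
have FU : ProperFilter (f @ U).
  by apply: fmap_proper_filter; exact: ultra_proper.
have /cC : (f @ U) (closure C) by apply: filterS UC => n; exact: subset_closure.
move=> [p [_ cp]]; exists p => W Wp.
have [//|UW] := in_ultra_setVsetC (f @^-1` W) UU.
by have [y []] := cp (~` W) W UW Wp.
Qed.

(** Pointwise limits and the common Lipschitz constant give closeness near each time; compactness of
    [-T, T] makes it uniform. The Lipschitz bound is only eventual because trajectories from [x n]
    are controlled only for |t| <= n. *)
Lemma equilipschitz_uniform_cauchy (R : realType) (V : normedModType R)
    (I : Type) (F : set_system I) (G : I -> R -> V) (C : R) {FF : Filter F} :
  (forall t, exists p : V, (fun n => G n t) @ F --> p) ->
  (forall T, \forall n \near F, forall s t, `|s| <= T -> `|t| <= T ->
    `|G n t - G n s| <= C * `|t - s|) ->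
  forall T eps : R, 0 < eps ->
  \forall n & m \near F, forall t, `|t| <= T -> `|G n t - G m t| <= eps.
Proof.
move=> cvgG lipG T eps eps0.
have := @segment_compact R (- T) T => /compact_near_coveringP.
move=> /(_ _ (filter_prod F F) (fun i t => `|G i.1 t - G i.2 t| <= eps) _).
have cover t : [set` `[- T, T]] t ->
    \forall t' \near t & i \near filter_prod F F, `|G i.1 t' - G i.2 t'| <= eps.
  rewrite /= in_itv /= -ler_norml => tT.
  have [p /cvgrPdist_lt /(_ (eps / 4)) Gp] := cvgG t.
  have {}Gp : \forall n \near F, `|p - G n t| < eps / 4.
    by apply: Gp; rewrite divr_gt0.
  pose C1 := `|C| + 1; have C10 : 0 < C1 by rewrite ltr_wpDl.
  have near_t : \forall t' \near t, `|t' - t| <= 1 /\ `|t' - t| <= eps / 4 / C1.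
    near=> t'; split; rewrite distrC; near: t'; apply: cvgr_dist_le => //.
    by rewrite !divr_gt0.
  (* One eps / 4 comes from convergence at [t], the other from the Lipschitz bound. *)
  pose Q n := forall t', `|t' - t| <= 1 ->
    `|t' - t| <= eps / 4 / C1 -> `|G n t' - p| <= eps / 2.
  have near_n : \forall n \near F, Q n.
    near=> n; move=> t' t't1 t'te.
    have -> : G n t' - p = (G n t' - G n t) - (p - G n t).
      by rewrite opprB addrA subrK.
    apply: le_trans (ler_normB _ _) _.
    have h1 : `|p - G n t| < eps / 4 by near: n.
    have h2 : `|G n t' - G n t| <= C * `|t' - t|.
      (* The radius [T + 1] leaves room for [t'], which may lie outside [-T, T]. *)
      have h : forall s t, `|s| <= T + 1 -> `|t| <= T + 1 ->
        `|G n t - G n s| <= C * `|t - s| by near: n; exact: lipG.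
      apply: h; first by rewrite (le_trans tT)// lerDl.
      have -> : t' = t + (t' - t) by rewrite addrC subrK.
      by rewrite (le_trans (ler_normD _ _))// lerD.
    have h3 : C * `|t' - t| <= eps / 4.
      apply: (@le_trans _ _ (C1 * `|t' - t|)).
        by rewrite ler_wpM2r// (le_trans (ler_norm _))// lerDl.
      by rewrite mulrC -ler_pdivlMr.
    by lra.
  exists ([set t' | `|t' - t| <= 1 /\ `|t' - t| <= eps / 4 / C1],
          [set i | Q i.1 /\ Q i.2]) => /=.
    by split=> //; exists (Q, Q).
  move=> [t' i] [/= [t't1 t'te] [Q1 Q2]].
  have -> : G i.1 t' - G i.2 t' = (G i.1 t' - p) - (G i.2 t' - p).
    by rewrite opprB addrA subrK.
  apply: le_trans (ler_normB _ _) _.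
  by have := Q1 _ t't1 t'te; have := Q2 _ t't1 t'te; lra.
move=> /(_ cover); apply: filterS => -[n m] /= h t tT.
by apply: h; rewrite /= in_itv /= -ler_norml.
Unshelve. all: by end_near. Qed.

(** * Property (C) for LS-flows *)

Lemma lipschitz_ge0 (R : realType) (V W : normedModType R) (f : V -> W) :
  lipschitz f -> exists2 k : R, 0 <= k &
    forall x y, `|f x - f y| <= k * `|x - y|.
Proof.
move=> /pinfty_ex_gt0[k k0 hk]; exists k => [|x y]; first exact: ltW.
exact: (hk (x, y)).
Qed.

Theorem lemma2p7 (R : realType) (H : completeNormedModType R)
    (dot : {dot H for idfun}%R) (L : {linear H -> H}%R) (phi : R -> H -> H)
    (hdot : induces_norm dot) (hsep : separable H)
    (hL : LS_operator dot L) (hphi : LS_flow L phi) :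
  property_C phi.
Proof.
case: hL => /bounded_operator_ge0[M M0 L_le] L_sa [g [bg gL _]] _.
have [A A0 g_le] := bounded_operator_ge0 bg.
have L_ge x : `|x| <= A * `|L x| by rewrite -{1}(gL x).
case: hphi => [[_ phi0 _] [F [/lipschitz_ge0[k k0 Fk] [K Kcc FE]] phiF]].
move=> x bx; set O := \bigcup_n _ in bx.
have inO n t : `|t| <= n%:R -> O (phi t (x n)).
  by move=> tn; exists n => //; exists t => //; rewrite /= in_itv /= -ler_norml.
have /pinfty_ex_gt0[B B0 OB] := bx.
have phiB n t : `|t| <= n%:R -> `|phi t (x n)| <= B by move=> /inO/OB.
have K_lip y z : `|K y - K z| <= (k + M) * `|y - z|.
  have -> : K y - K z = (F y - F z) - L (y - z).
    by rewrite !FE linearB [- (L z + _)]opprD addrACA [RHS]addrC addKr.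
  by rewrite mulrDl (le_trans (ler_normB _ _))// lerD.
(* [C] bounds the speed of a trajectory inside the ball of radius [B], since |F y| <= |F 0| + k
   |y|. *)
pose C := `|F 0| + k * B.
have FC n t : `|t| <= n%:R -> `|F (phi t (x n))| <= C.
  move=> /phiB h; rewrite -[F _](subrK (F 0)) addrC /C.
  rewrite (le_trans (ler_normD _ _))// lerD2l (le_trans (Fk _ _))// subr0.
  by rewrite ler_wpM2l.
have C0 : 0 <= C by rewrite addr_ge0// mulr_ge0// ltW.
have phi_lip n s t : `|s| <= n%:R -> `|t| <= n%:R ->
    `|phi t (x n) - phi s (x n)| <= C * `|t - s|.
  wlog st : s t / s <= t => [wl|].
    case: (leP s t) => [/wl h sn tn|/ltW/wl h sn tn]; first exact: h.
    by rewrite (distrC t) (distrC (phi t _)); exact: h.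
  move=> sn tn; rewrite (ger0_norm (_ : 0 <= t - s)) ?subr_ge0//.
  apply: (curve_lipschitz hdot st (phiF (x n))) => r /andP[sr rt]; apply: FC.
  move: sn tn; rewrite !ler_norml => /andP[? _] /andP[_ ?].
  by rewrite (le_trans _ sr)// (le_trans rt).
pose G n t := K (phi t (x n)).
have [U [UU ooU]] := @ultraFilterLemma nat \oo _.
have UF : ProperFilter U by exact: ultra_proper.
have near_ge (T : R) : \forall n \near U, T <= n%:R.
  by apply: ooU; exact: nbhs_infty_ger.
(* Once n >= |t|, the point [G n t] lies in the image of [O] under [K], which is precompact as [O]
   is bounded. *)
have Gcvg t : exists p : H, (fun n => G n t) @ U --> p.
  apply: (ultrafilter_cvg_precompact UU (Kcc _ bx)).
  by apply: filterS (near_ge `|t|) => n /inO h; exists (phi t (x n)).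
have Glip (T : R) : \forall n \near U, forall s t, `|s| <= T -> `|t| <= T ->
    `|G n t - G n s| <= (k + M) * C * `|t - s|.
  apply: filterS (near_ge T) => n Tn s t sT tT.
  rewrite (le_trans (K_lip _ _))// -mulrA ler_wpM2l ?addr_ge0//.
  by rewrite phi_lip// (le_trans _ Tn).
have cauchy_x : cauchy (x @ U).
  apply/cauchy_ballP => e e0.
  have e20 : 0 < e / 2 by rewrite divr_gt0.
  have B20 : 0 <= B + B by rewrite addr_ge0// ltW.
  have [eps [T [eps0 T1 small]]] :=
    linear_ode_small_at0 hdot L_sa A0 L_ge M0 L_le B20 e20.
  rewrite near_map2.
  have GU := equilipschitz_uniform_cauchy (FF := @filter_filter _ _ UF)
    Gcvg Glip T eps0.
  (* Only from index [T] on are the trajectories known to stay bounded by [B] on [-T, T]. *)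
  have TU : \forall i \near filter_prod U U, T <= i.1%:R /\ T <= i.2%:R.
    exists ([set n | T <= n%:R], [set n | T <= n%:R]) => //.
    by split; exact: near_ge.
  apply: filterS (filterI TU GU) => -[n m] [/= [Tn Tm] Gnm].
  rewrite -ball_normE /= -[x n]phi0 -[x m]phi0.
  apply: (@le_lt_trans _ _ (e / 2)); last by lra.
  apply: (small (fun t => phi t (x n) - phi t (x m))
    (fun t => G n t - G m t)) => //.
    move=> t; apply: is_derive_eq (is_deriveB (phiF (x n) t) (phiF (x m) t)) _.
    by rewrite !FE linearB opprD addrACA.
  move=> t tT; rewrite (le_trans (ler_normB _ _))// lerD// phiB//.
    by rewrite (le_trans tT).
  by rewrite (le_trans tT).
have /cvgrPdist_lt xl : cvg (x @ U) by exact: cauchy_cvg.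
apply: (@frequently_near_subsequence _ _ _ (lim (x @ U))) => e e0 N.
(* [U] contains every tail, so points close to its limit occur at arbitrarily large indices. *)
have NU : \forall n \near U, (N <= n)%N by apply: ooU; exact: nbhs_infty_ge.
have [n [Nn xn]] := filter_ex (filterI NU (xl e e0)).
by exists n.
Qed.
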